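(* Every conjugacy closed loop is an Osborn loop.
   Context: For a loop $Q$ let $L_x\colon y\mapsto xy$ and $R_x\colon y\mapsto yx$ be the left and right translations. $Q$ is left conjugacy closed (LCC) if $L_xL_yL_x^{-1}$ is a left translation of $Q$ for all $x,y\in Q$; it is right conjugacy closed (RCC) if $R_xR_yR_x^{-1}$ is a right translation of $Q$ for all $x,y\in Q$; it is conjugacy closed (CC) if it is both LCC and RCC. A loop $Q$ is an Osborn loop if for each $x\in Q$ there exists a permutation $\alpha_x$ of $Q$ such that $\alpha_x(y)\cdot(zx)=x((yz)x)$ for all $y,z\in Q$. *)

(* Defs.v *)
From HB Require Import structures.
From mathcomp Require Import all_boot.

Set Implicit Arguments.
Unset Strict Implicit.
Unset Printing Implicit Defensive.

Local Open Scope group_scope.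

(* The unit laws are restated over BaseUMagma instead of being inherited from *)
(* UMagma, since the latter includes a choice structure, which the carrier of *)
(* a loop need not have.                                                      *)
(*                                                                            *)
(* The translations of a loop are permutations; their inverses are the two    *)
(* divisions: ldiv x y is x \ y = L_x^-1 y, and rdiv y x is y / x = R_x^-1 y. *)
HB.mixin Record BaseUMagma_isLoop Q of BaseUMagma Q := {
  loop_mul1g : left_id 1 (@mul Q);
  loop_mulg1 : right_id 1 (@mul Q);
  ldiv : Q -> Q -> Q;
  rdiv : Q -> Q -> Q;
  mulKldiv : forall x : Q, cancel (fun y => x * y) (ldiv x);
  ldivKmul : forall x : Q, cancel (ldiv x) (fun y => x * y);
  mulKrdiv : forall x : Q, cancel (fun y => y * x) (fun y => rdiv y x);
  rdivKmul : forall x : Q, cancel (fun y => rdiv y x) (fun y => y * x)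
}.

#[short(type="loopType")]
HB.structure Definition Loop :=
  {Q of BaseUMagma_isLoop Q & BaseUMagma Q}.

Bind Scope group_scope with Loop.sort.

Section Translations.

Variable Q : loopType.
Implicit Types x y z : Q.

Definition ltrans x : Q -> Q := fun y => x * y.
Definition rtrans x : Q -> Q := fun y => y * x.
Definition ltransV x : Q -> Q := fun y => ldiv x y.
Definition rtransV x : Q -> Q := fun y => rdiv y x.

Lemma ltransK x : cancel (ltrans x) (ltransV x).
Proof. exact: mulKldiv. Qed.

Lemma ltransVK x : cancel (ltransV x) (ltrans x).
Proof. exact: ldivKmul. Qed.

Lemma rtransK x : cancel (rtrans x) (rtransV x).
Proof. exact: mulKrdiv. Qed.

Lemma rtransVK x : cancel (rtransV x) (rtrans x).
Proof. exact: rdivKmul. Qed.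

Definition is_ltrans (f : Q -> Q) : Prop := exists z, f =1 ltrans z.
Definition is_rtrans (f : Q -> Q) : Prop := exists z, f =1 rtrans z.

End Translations.

Definition left_conjugacy_closed (Q : loopType) : Prop :=
  forall x y : Q, is_ltrans (ltrans x \o ltrans y \o ltransV x).

Definition right_conjugacy_closed (Q : loopType) : Prop :=
  forall x y : Q, is_rtrans (rtrans x \o rtrans y \o rtransV x).

Definition conjugacy_closed (Q : loopType) : Prop :=
  left_conjugacy_closed Q /\ right_conjugacy_closed Q.

Definition osborn_loop (Q : loopType) : Prop :=
  forall x : Q, exists2 alpha : Q -> Q, bijective alpha &
    forall y z : Q, alpha y * (z * x) = x * ((y * z) * x).

(* Main.v *)
From mathcomp Require Import all_boot.
Require Import Defs.

Local Open Scope group_scope.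

(** In a conjugacy closed loop the conjugates of translations can be computed
    explicitly: evaluating [L_x L_y L_x^-1 = L_c] at [x] forces
    [c = (xy)/x], and evaluating [R_x R_z R_x^-1 = R_d] at [x] forces
    [d = x\(zx)]. Hence left multiplication by [x], and right multiplication
    by [x], distribute over products up to a correction of one factor
    ([lcc_mul] and [rcc_mul]). The two corrections fit together: by [rcc_mul],
    [(yz)x = (yx)(x\(zx))], and multiplying this on the left by [x] with
    [lcc_mul] cancels the division in the second factor, leaving
    [x((yz)x) = ((x(yx))/x)(zx)]. Thus [alpha_x = R_x^-1 L_x R_x], a
    permutation, witnesses the Osborn property. *)

(** The law [L_x L_y = L_c L_x] read at a point; its value at [1] is [xy = cx],
    which determines [c]. *)
Lemma lcc_mul (Q : loopType) : left_conjugacy_closed Q ->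
  forall x y w : Q, x * (y * w) = rdiv (x * y) x * (x * w).
Proof.
move=> lcc x y w; have [c cE] := lcc x y.
have conj u : x * (y * u) = c * (x * u).
  by have := cE (x * u); rewrite /= /ltransV mulKldiv.
have := conj 1; rewrite !loop_mulg1 => ->.
by rewrite mulKrdiv conj.
Qed.

(** The mirror image of [lcc_mul]: [R_x R_z = R_d R_x], where the value at [1]
    is [zx = xd]. *)
Lemma rcc_mul (Q : loopType) : right_conjugacy_closed Q ->
  forall x w z : Q, (w * z) * x = (w * x) * ldiv x (z * x).
Proof.
move=> rcc x w z; have [d dE] := rcc x z.
have conj u : (u * z) * x = (u * x) * d.
  by have := dE (u * x); rewrite /= /rtransV mulKrdiv.
have := conj 1; rewrite !loop_mul1g => ->.
by rewrite mulKldiv conj.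
Qed.

Theorem corollary3p6 (Q : loopType) : conjugacy_closed Q -> osborn_loop Q.
Proof.
move=> [lcc rcc] x; exists (rtransV x \o (ltrans x \o rtrans x)).
  apply: bij_comp; first by exists (rtrans x); [exact: rtransVK|exact: rtransK].
  apply: bij_comp; first by exists (ltransV x); [exact: ltransK|exact: ltransVK].
  by exists (rtransV x); [exact: rtransK|exact: rtransVK].
by move=> y z; rewrite (@rcc_mul Q rcc x y z) (@lcc_mul Q lcc x) ldivKmul.
Qed.
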